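(* Let $y>1$. For $e\in\mathbb{R}^\kappa$ let $$\underline e[\omega^N,y]=\min_x\left\{e^Tx:\ x\in\mathcal{X},\ \underline\psi(a[\omega^N]_k,N;y)\le (A[\omega^N]x)_k\le\overline\psi(a[\omega^N]_k,N;y),\ k=1,\dots,\kappa\right\},$$ $$\overline e[\omega^N,y]=\max_x\left\{e^Tx:\ x\in\mathcal{X},\ \underline\psi(a[\omega^N]_k,N;y)\le (A[\omega^N]x)_k\le\overline\psi(a[\omega^N]_k,N;y),\ k=1,\dots,\kappa\right\}.$$ Then the probability of the event $$\underline e[\omega^N,y]\le e^T\beta\le\overline e[\omega^N,y]\quad\text{for all } e\in\mathbb{R}^\kappa$$ is at least $$1-2\kappa e\Big(y\big[\ln((y-1)N)+2\big]+2\Big)e^{-y},$$ where in this last expression $e$ denotes the base of natural logarithms.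
   Context: Single-state spatio-temporal Bernoulli process with memory depth $d$. Let $K,d,N\ge 1$ be integers and $\kappa=K+dK^2$. A random process $\omega_t=(\omega_{t1},\dots,\omega_{tK})\in\{0,1\}^K$, $-d+1\le t\le N$, is observed. Write $\omega^t=\{\omega_{sk}:-d+1\le s\le t,\ 1\le k\le K\}$ and $\omega_\tau^t=\{\omega_{sk}:\tau\le s\le t,\ 1\le k\le K\}$. The parameter vector $\beta\in\mathbb{R}^\kappa$ collects the reals $\beta_k$ ($1\le k\le K$) and $\beta^s_{k\ell}$ ($1\le s\le d$, $1\le k,\ell\le K$). For $t\ge1$, the conditional probability of $\omega_{tk}=1$ given $\omega^{t-1}$ is $$\beta_k+\sum_{s=1}^d\sum_{\ell=1}^K\beta^s_{k\ell}\,\omega_{(t-s)\ell},\quad 1\le k\le K.$$ Let $\mathcal{B}\subset\mathbb{R}^\kappa$ be the set of all $\beta$ satisfying, for all $k\le K$, $$0\le \beta_k+\sum_{s=1}^d\sum_{\ell=1}^K\min[\beta^s_{k\ell},0],\qquad 1\ge \beta_k+\sum_{s=1}^d\sum_{\ell=1}^K\max[\beta^s_{k\ell},0].$$ A convex compact set $\mathcal{X}\subset\mathcal{B}$ containing the true parameter vector $\beta$ is given. The matrix $\eta(\omega_{t-d}^{t-1})\in\{0,1\}^{\kappa\times K}$ is the one for which, for every $x\in\mathbb{R}^\kappa$ (with coordinates indexed as those of $\beta$), the $k$-th entry of $\eta^T(\omega_{t-d}^{t-1})x$ is $x_k+\sum_{s=1}^d\sum_{\ell=1}^K x^s_{k\ell}\omega_{(t-s)\ell}$;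 here $\eta^T(\cdot)$ is the transpose of $\eta(\cdot)$. Thus the conditional expectation of $\omega_t$ given $\omega^{t-1}$ is $\eta^T(\omega_{t-d}^{t-1})\beta$. All probabilities are conditional on a fixed realization of the initial fragment $\omega_{-d+1}^0$. Set $$A[\omega^N]=\frac1N\sum_{t=1}^N\eta(\omega_{t-d}^{t-1})\eta^T(\omega_{t-d}^{t-1}),\qquad a[\omega^N]=\frac1N\sum_{t=1}^N\eta(\omega_{t-d}^{t-1})\omega_t,$$ with $a[\omega^N]_k$ the $k$-th entry of $a[\omega^N]$. For $\nu\in[0,1]$ and $y>1$ define $$\underline\psi(\nu,N;y)=\begin{cases}(N+2y)^{-1}\left[N\nu+\frac{2y}{3}-\sqrt{2N\nu y+\frac{y^2}{3}-\frac{2y}{N}\left(\frac y3-\nu N\right)^2}\right] & \text{if }\nu>\frac{y}{3N},\\ 0&\text{otherwise,}\end{cases}$$ $$\overline\psi(\nu,N;y)=\begin{cases}(N+2y)^{-1}\left[N\nu+\frac{4y}{3}+\sqrt{2N\nu y+\frac{5y^2}{3}-\frac{2y}{N}\left(\frac y3+\nu N\right)^2}\right] & \text{if }\nu<1-\frac{y}{3N},\\ 1&\text{otherwise.}\end{cases}$$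
   Formalization: The formal statement additionally assumes y[ln((y-1)N)+2]+2 ≥ 1; without it the claim is false for y very close to 1, e.g. K=d=N=1, y=1+exp(-10), where the stated lower bound exceeds 1. Only cases with (y-1)N < exp(-2) are excluded. *)

(* Defs.v *)
From HB Require Import structures.
From mathcomp Require Import all_boot all_order all_algebra.
From mathcomp Require Import all_classical all_reals all_analysis.
Import Order.TTheory GRing.Theory Num.Theory.
Import numFieldNormedType.Exports.

Set Implicit Arguments.
Unset Strict Implicit.
Unset Printing Implicit Defensive.

Local Open Scope classical_set_scope.
Local Open Scope ring_scope.

(* 'inl k' indexes beta_k; 'inr (s, k, l)' indexes beta^{s+1}_{kl}: ordinals
   start at 0 whereas lags start at 1. *)
Definition coord (K d : nat) : finType := ('I_K + 'I_d * 'I_K * 'I_K)%type.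

Definition kappa (K d : nat) : nat := (K + d * K ^ 2)%N.

Lemma card_coord K d : #|coord K d| = kappa K d.
Proof.
by rewrite card_sum !card_prod !card_ord /kappa -mulnA expnS expn1.
Qed.

Definition coord_ord K d (c : coord K d) : 'I_(kappa K d) :=
  cast_ord (card_coord K d) (enum_rank c).

Definition ord_coord K d (i : 'I_(kappa K d)) : coord K d :=
  enum_val (cast_ord (esym (card_coord K d)) i).

Lemma coord_ordK K d : cancel (@coord_ord K d) (@ord_coord K d).
Proof. by move=> c; rewrite /ord_coord /coord_ord cast_ordK enum_rankK. Qed.

Lemma ord_coordK K d : cancel (@ord_coord K d) (@coord_ord K d).
Proof. by move=> i; rewrite /ord_coord /coord_ord enum_valK cast_ordKV. Qed.

(* The values omega_{tk}, indexed by all integer times; everything below only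
   reads the times 1 - d <= t <= N. *)
Definition trajectory (K : nat) : Type := int -> 'I_K -> bool.

Section Estimation.
Variables (R : realType) (K d : nat).
Implicit Types (x beta : 'cV[R]_(kappa K d)) (om : trajectory K) (t : int).

Definition base x (k : 'I_K) : R := x (coord_ord (inl k)) 0.

Definition influence x (s : 'I_d) (k l : 'I_K) : R :=
  x (coord_ord (inr (s, k, l))) 0.

Definition rate x om t (k : 'I_K) : R :=
  base x k +
  \sum_(s < d) \sum_(l < K) influence x s k l * (om (t - s.+1%:Z) l)%:R.

Definition admissible : set 'cV[R]_(kappa K d) :=
  [set beta | forall k : 'I_K,
     0 <= base beta k +
          \sum_(s < d) \sum_(l < K) Num.min (influence beta s k l) 0 /\
     base beta k +
          \sum_(s < d) \sum_(l < K) Num.max (influence beta s k l) 0 <= 1].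

(* eta om t is the regressor built from the values of om at t - d, ..., t - 1 *)
Definition eta om t : 'M[R]_(kappa K d, K) :=
  \matrix_(i < kappa K d, k < K)
    match ord_coord i with
    | inl k' => (k' == k)%:R
    | inr (s, k', l) => (k' == k)%:R * (om (t - s.+1%:Z) l)%:R
    end.

Lemma eta_trE om t x (k : 'I_K) : ((eta om t)^T *m x) k 0 = rate x om t k.
Proof.
rewrite mxE (reindex (@coord_ord K d)) /=; last first.
  by exists (@ord_coord K d) => ? _; [exact: coord_ordK | exact: ord_coordK].
rewrite big_sumType /=; congr (_ + _).
  rewrite (bigD1 k) //= !mxE coord_ordK eqxx mul1r big1 ?addr0 //.
  by move=> j /negPf jk; rewrite !mxE coord_ordK jk mul0r.
transitivity (\sum_(s < d) \sum_(k' < K) \sum_(l < K)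
    (eta om t)^T k (coord_ord (inr (s, k', l))) * influence x s k' l).
  by rewrite pair_bigA pair_bigA; apply: eq_bigr => -[[s k'] l].
apply: eq_bigr => s _; rewrite (bigD1 k) //= [X in _ + X]big1 ?addr0.
  by apply: eq_bigr => l _; rewrite !mxE coord_ordK eqxx mul1r mulrC.
by move=> j /negPf jk; apply: big1 => l _; rewrite !mxE coord_ordK jk !mul0r.
Qed.

Definition outcome om t : 'cV[R]_K := \col_k (om t k)%:R.

Definition Amat (N : nat) om : 'M[R]_(kappa K d) :=
  N%:R^-1 *: \sum_(1 <= t < N.+1) eta om t%:Z *m (eta om t%:Z)^T.

Definition avec (N : nat) om : 'cV[R]_(kappa K d) :=
  N%:R^-1 *: \sum_(1 <= t < N.+1) eta om t%:Z *m outcome om t%:Z.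

Definition psi_lower (nu : R) (N : nat) (y : R) : R :=
  if y / (3 * N%:R) < nu then
    (N%:R + 2 * y)^-1 *
    (N%:R * nu + 2 * y / 3 -
     Num.sqrt (2 * N%:R * nu * y + y ^+ 2 / 3 -
               2 * y / N%:R * (y / 3 - nu * N%:R) ^+ 2))
  else 0.

Definition psi_upper (nu : R) (N : nat) (y : R) : R :=
  if nu < 1 - y / (3 * N%:R) then
    (N%:R + 2 * y)^-1 *
    (N%:R * nu + 4 * y / 3 +
     Num.sqrt (2 * N%:R * nu * y + 5 * y ^+ 2 / 3 -
               2 * y / N%:R * (y / 3 + nu * N%:R) ^+ 2))
  else 1.

Definition feasible (X : set 'cV[R]_(kappa K d)) (N : nat) om (y : R) :
    set 'cV[R]_(kappa K d) :=
  [set x | X x /\ forall i : 'I_(kappa K d),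
     psi_lower (avec N om i 0) N y <= (Amat N om *m x) i 0 /\
     (Amat N om *m x) i 0 <= psi_upper (avec N om i 0) N y].

(* Infimum and supremum in \bar R: they are attained when the feasible set is
   nonempty and X is compact (e_lower_min, e_upper_max), and equal +oo and -oo
   respectively when it is empty. *)
Definition e_lower X N om y (e : 'cV[R]_(kappa K d)) : \bar R :=
  ereal_inf [set ((e^T *m x) 0 0)%:E | x in feasible X N om y].

Definition e_upper X N om y (e : 'cV[R]_(kappa K d)) : \bar R :=
  ereal_sup [set ((e^T *m x) 0 0)%:E | x in feasible X N om y].

Lemma mulmx_coord_continuous m n (M : 'M[R]_(m, n)) i :
  continuous (fun x : 'cV[R]_n => (M *m x) i 0).
Proof.
move=> x; rewrite (_ : (fun _ => _) =
  (fun z : 'cV[R]_n => \sum_j M i j * z j 0)); last first.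
  by apply/funext => z; rewrite mxE.
apply: (@cvg_big _ _ _ _ _ _ _ (nbhs x)) => [|j _].
  exact: add_continuous.
apply: (@cvgM _ _ _ _ (cst (M i j)) (fun z : 'cV[R]_n => z j 0)).
  exact: cvg_cst.
exact: coord_continuous.
Qed.

Lemma feasible_compact X N om y : compact X -> compact (feasible X N om y).
Proof.
move=> cX.
rewrite (_ : feasible X N om y = X `&` \bigcap_(i in [set: 'I_(kappa K d)])
  ((fun x : 'cV[R]_(kappa K d) => (Amat N om *m x) i 0) @^-1`
    `[psi_lower (avec N om i 0) N y, psi_upper (avec N om i 0) N y])).
  apply: compact_closedI => //; apply: closed_bigI => i _.
  apply: preimage_closed; last exact: interval_closed.
  by move=> x _; exact: mulmx_coord_continuous.
apply/seteqP; split=> x /= [Xx H]; split=> // i.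
  by move=> _ /=; rewrite in_itv /=; apply/andP; exact: H.
by have := H i I; rewrite /= in_itv /= => /andP[].
Qed.

Lemma e_lower_min X N om y e : compact X -> feasible X N om y !=set0 ->
  exists2 x, feasible X N om y x & e_lower X N om y e = ((e^T *m x) 0 0)%:E.
Proof.
move=> cX F0; have [x] := compact_EVT_min F0 (@feasible_compact X N om y cX)
  (continuous_subspaceT (@mulmx_coord_continuous _ _ e^T 0)).
rewrite inE => Fx xmin; exists x => //; apply/eqP; rewrite eq_le.
apply/andP; split; first by apply: ereal_inf_lbound; exists x.
by apply: le_ereal_inf_tmp => _ [z Fz <-]; rewrite lee_fin xmin// inE.
Qed.

Lemma e_upper_max X N om y e : compact X -> feasible X N om y !=set0 ->
  exists2 x, feasible X N om y x & e_upper X N om y e = ((e^T *m x) 0 0)%:E.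
Proof.
move=> cX F0; have [x] := compact_EVT_max F0 (@feasible_compact X N om y cX)
  (continuous_subspaceT (@mulmx_coord_continuous _ _ e^T 0)).
rewrite inE => Fx xmax; exists x => //; apply/eqP; rewrite eq_le.
apply/andP; split; last by apply: ereal_sup_ubound; exists x.
by apply: ge_ereal_sup => _ [z Fz <-]; rewrite lee_fin xmax// inE.
Qed.

End Estimation.

Section Process.
Variables (R : realType) (K d N : nat).
Variables (disp : measure_display) (T : measurableType disp).
Variable (P : probability T R).

Definition cond_prob (A B : set T) : R := fine (P (A `&` B)) / fine (P B).

(* the event omega^t = h^t *)
Definition past (om : T -> trajectory K) (h : trajectory K) (t : int) : set T :=
  [set w | forall (s : int) (k : 'I_K),
     1 - d%:Z <= s <= t -> om w s k = h s k].

(* Only the marginal conditional laws of omega_{t1}, ..., omega_{tK} given the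
   past are prescribed; they need not be conditionally independent. *)
Definition bernoulli_process (beta : 'cV[R]_(kappa K d))
    (om : T -> trajectory K) : Prop :=
  (forall (t : int) (k : 'I_K), 1 - d%:Z <= t <= N%:Z ->
     measurable_fun setT (fun w => om w t k)) /\
  (forall (t : int) (k : 'I_K) (h : trajectory K), 1 <= t <= N%:Z ->
     (0 < P (past om h (t - 1)))%E ->
     cond_prob [set w | om w t k] (past om h (t - 1)) = rate beta h t k).

End Process.

(* Main.v *)
Require Import Defs.
From mathcomp Require Import all_boot all_order all_algebra.
From mathcomp Require Import all_classical all_reals all_analysis.
From mathcomp Require Import zify ring lra.
Import Order.TTheory GRing.Theory Num.Theory.
Import numFieldNormedType.Exports.
Local Open Scope classical_set_scope.
Local Open Scope ring_scope.

(* If beta is feasible for the data, then e^T beta lies between the two optimal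
   values for every e.  Infeasibility means that some coordinate i violates one
   of its two constraints; with nu = a_i, m = (A beta)_i and v = N m (1 - m), the
   functions psi are such that this reads |N (nu - m)| >= y/3 + sqrt (2 y v).
   Here N (nu - m) is a sum of increments eta_{ik} (omega_{tk} - rate_{tk}),
   because row i of eta has a single nonzero column, and by Jensen's inequality
   v dominates the sum of the conditional variances.  Bernstein's exponential
   supermartingale with the optimal parameter for a known v would give the
   probability e^{-y}; as v is random, a geometric grid of at most
   y (ln ((y - 1) N) + 2) + 2 parameters is used, at the price of a factor e. *)

Set Implicit Arguments.
Unset Strict Implicit.
Unset Printing Implicit Defensive.

(** * Exponential moments of centred Bernoulli variables *)

Section Exponential.
Variable R : realType.
Implicit Types x u q t : R.

Lemma MVT_is_derive (f df : R -> R) (a b : R) : a <= b ->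
  (forall x, is_derive x 1 f (df x)) ->
  exists2 c, a <= c <= b & f b - f a = df c * (b - a).
Proof.
move=> ab fdf; have [|c] := @MVT_segment R f df a b ab (fun x _ => fdf x).
  apply: continuous_subspaceT => x.
  by apply/differentiable_continuous/derivable1_diffP; have [] := fdf x.
by rewrite in_itv /= => cab fE; exists c.
Qed.

(** The first factor vanishes at 0 and has derivative [x ^+ 2 * expR (- x)], so it has the sign of
    [x]. It is the derivative of the [f] used for [expR_pade]. *)
Lemma expR_pade_aux x :
  0 <= (2 - (2 + 2 * x + x ^+ 2) * expR (- x)) * x.
Proof.
pose f (z : R) : R := 2 - (2 + 2 * z + z ^+ 2) * expR (- z).
have df (z : R) : is_derive z 1 f (z ^+ 2 * expR (- z)).
  rewrite /f; apply: is_derive_eq; rewrite /GRing.scale /=; ring.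
have f0 : f 0 = 0 by rewrite /f oppr0 expR0; ring.
have df0 (c : R) : 0 <= c ^+ 2 * expR (- c) by rewrite mulr_ge0 ?sqr_ge0 ?expR_ge0.
rewrite -/(f x); have [x0|x0] := leP 0 x.
  have [c _] := MVT_is_derive x0 df; rewrite f0 !subr0 => ->.
  by apply: mulr_ge0 => //; apply: mulr_ge0.
have [c _] := MVT_is_derive (ltW x0) df; rewrite f0 !sub0r => fE.
have -> : f x = c ^+ 2 * expR (- c) * x by lra.
rewrite -[X in _ <= X]mulrA.
by apply: mulr_ge0 (df0 c) _; rewrite -expr2 sqr_ge0.
Qed.

(* The right-hand side over 6 - 2x is the [2/1] Pade approximant of exp. *)
Lemma expR_pade x : expR x * (6 - 2 * x) <= 6 + 4 * x + x ^+ 2.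
Proof.
pose f (z : R) : R := (6 + 4 * z + z ^+ 2) * expR (- z) + 2 * z.
have df (z : R) : is_derive z 1 f (2 - (2 + 2 * z + z ^+ 2) * expR (- z)).
  rewrite /f; apply: is_derive_eq; rewrite /GRing.scale /=; ring.
have f0 : f 0 = 6 by rewrite /f oppr0 expR0; ring.
have fx : 6 <= f x.
  rewrite -f0 -subr_ge0; have [x0|x0] := leP 0 x.
    have [c /andP[c0 _] ->] := MVT_is_derive x0 df; have := expR_pade_aux c.
    set k := 2 - _ => kc; rewrite subr0; move: c0.
    (* The sign of [k * c] says nothing about [k] at [c = 0]; there [k] is computed directly. *)
    rewrite le_eqVlt => /predU1P[c0|c0]; last first.
      by rewrite mulr_ge0 // -(pmulr_lge0 _ c0).
    by rewrite /k -c0 oppr0 expR0; nra.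
  have [c /andP[_ c0]] := MVT_is_derive (ltW x0) df; have := expR_pade_aux c.
  set k := 2 - _ => kc; rewrite sub0r -[f x - _]opprB => ->.
  rewrite mulrN opprK; move: c0; rewrite le_eqVlt => /predU1P[c0|c0].
    by rewrite /k c0 oppr0 expR0; nra.
  by rewrite mulr_le0 ?(ltW x0) // -(nmulr_lge0 _ c0).
have := ler_wpM2r (expR_ge0 x) fx.
have -> : f x * expR x =
    (6 + 4 * x + x ^+ 2) * (expR x * expR (- x)) + 2 * x * expR x.
  by rewrite /f; ring.
by rewrite expRxMexpNx_1; lra.
Qed.

(* Bernstein's bound in the parametrization lambda = 3t/(3+t), where
   t = sqrt (2y/v) is optimal for the variance v and the level y. *)
Definition tilt t : R := 3 * t / (3 + t).
Definition cgf t : R := 3 * t ^+ 2 / (2 * (3 + t)).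

(** For x = [tilt t * u] the Pade bound reads exp x <= 1 + x + x^2 / (2 (1 - x/3)). As u <= 1, 1 -
    x/3 is at least 3 / (3 + t), and [cgf t] is the resulting coefficient of u^2. *)
Lemma expR_tilt t u : 0 <= t -> u <= 1 ->
  expR (tilt t * u) <= 1 + tilt t * u + cgf t * u ^+ 2.
Proof.
move=> t0 u1; have t3 : 0 < 3 + t by lra.
set x := tilt t * u; have := expR_pade x.
have x3 : x < 3.
  by rewrite /x /tilt mulrAC ltr_pdivrMr //; nra.
have xE : x * (3 + t) = 3 * t * u by rewrite /x /tilt; field; lra.
have cE : cgf t * (2 * (3 + t)) = 3 * t ^+ 2.
  by rewrite /cgf; field; lra.
set c := cgf t in cE *; move=> ex.
rewrite -(ler_pM2r (_ : 0 < 6 - 2 * x)); last by lra.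
apply: le_trans ex _.
rewrite -(ler_pM2r (_ : 0 < (3 + t) ^+ 2)); last by rewrite exprn_gt0.
rewrite -subr_ge0.
have -> : (1 + x + c * u ^+ 2) * (6 - 2 * x) * (3 + t) ^+ 2 -
   (6 + 4 * x + x ^+ 2) * (3 + t) ^+ 2 =
   c * (2 * (3 + t)) * u ^+ 2 * (3 * (3 + t) - x * (3 + t))
   - 3 * (x * (3 + t)) ^+ 2 by ring.
rewrite cE xE.
have -> : 3 * t ^+ 2 * u ^+ 2 * (3 * (3 + t) - 3 * t * u) -
   3 * (3 * t * u) ^+ 2 = 9 * t ^+ 2 * u ^+ 2 * t * (1 - u) by ring.
have u1' : 0 <= 1 - u by lra.
by rewrite !(sqr_ge0, mulr_ge0).
Qed.

Lemma cgf_ge0 t : 0 <= t -> 0 <= cgf t.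
Proof. by move=> t0; rewrite /cgf divr_ge0 ?mulr_ge0 ?sqr_ge0 //; lra. Qed.

(** When [expR_tilt] is averaged over the two outcomes, the linear terms cancel and the quadratic
    ones add up to the variance. The sign serves both tails. *)
Lemma bernoulli_mgf t q (b : bool) : 0 <= t -> 0 <= q <= 1 ->
  q * expR (tilt t * ((-1) ^+ b * (1 - q))) +
  (1 - q) * expR (tilt t * ((-1) ^+ b * (0 - q))) <=
  expR (cgf t * (q * (1 - q))).
Proof.
move=> t0 /andP[q0 q1]; apply: le_trans (expR_ge1Dx _).
have e1 : (-1) ^+ b * (1 - q) <= 1 by case: (b) => /=; rewrite ?expr0 ?expr1; lra.
have e0 : (-1) ^+ b * (0 - q) <= 1 by case: (b) => /=; rewrite ?expr0 ?expr1; lra.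
have q1' : 0 <= 1 - q by lra.
apply: le_trans (lerD (ler_wpM2l q0 (expR_tilt t0 e1))
  (ler_wpM2l q1' (expR_tilt t0 e0))) _.
rewrite !exprMn sqrr_sign; set s := (-1) ^+ b; set l := tilt t; set c := cgf t.
by rewrite le_eqVlt; apply/orP; left; apply/eqP; ring.
Qed.

Lemma masked_bernoulli_mgf t q (b z : bool) : 0 <= t -> 0 <= q <= 1 ->
  q * expR (tilt t * ((-1) ^+ b * (z%:R * true%:R - z%:R * q)) -
            cgf t * (z%:R * q * (1 - z%:R * q))) +
  (1 - q) * expR (tilt t * ((-1) ^+ b * (z%:R * false%:R - z%:R * q)) -
            cgf t * (z%:R * q * (1 - z%:R * q))) <= 1.
Proof.
move=> t0 q01; have := bernoulli_mgf b t0 q01; case: z.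
  have -> : true%:R = 1 :> R by []; have -> : false%:R = 0 :> R by [].
  rewrite !mul1r; move: (tilt t) (cgf t) => l c mgf.
  rewrite ![expR (_ - _)]expRD expRN [q * _]mulrA [(1 - q) * (_ * _)]mulrA -mulrDl.
  by rewrite ler_pdivrMr ?expR_gt0 // mul1r.
have -> : true%:R = 1 :> R by []; have -> : false%:R = 0 :> R by [].
by move=> _; rewrite !mul0r subrr !mulr0 subr0 expR0 !mulr1 addrC subrK.
Qed.

End Exponential.

(** * Inversion of the functions psi, and the grid of parameters *)

Section Intervals.
Variable R : realType.
Implicit Types (y nu m n w S v t : R) (N j M : nat).

Lemma psi_lower_gt y nu m N : (0 < N)%N -> 0 < y -> 0 <= m <= 1 ->
  m < psi_lower nu N y ->
  y / 3 + Num.sqrt (2 * y * (N%:R * m * (1 - m))) <= N%:R * (nu - m).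
Proof.
move=> N0 y0 /andP[m0 m1]; rewrite /psi_lower; case: ifP => [|_]; last first.
  by rewrite ltNge m0.
have n0 : 0 < N%:R :> R by rewrite ltr0n.
move: n0; set n : R := N%:R; set D := (X in Num.sqrt X) => n0.
rewrite ltr_pdivrMr ?mulr_gt0 // => ynu.
rewrite mulrC ltr_pdivlMr; last by lra.
set L := n * nu + 2 * y / 3 - (n + 2 * y) * m.
move=> mL; have {mL} : Num.sqrt D < L by rewrite /L; lra.
move=> DL; have L0 : 0 < L by apply: le_lt_trans DL; exact: sqrtr_ge0.
have {}DL : D < L ^+ 2.
  by rewrite -(ltr_sqrt _ (exprn_gt0 2 L0)) sqrtr_sqr gtr0_norm.
pose c := n * nu - y / 3; have c0 : 0 < c by rewrite /c; lra.
(* psi_lower is the smaller root in m of the corresponding equation. *)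
have Q0 : 2 * y * (n * m * (1 - m)) < (c - n * m) ^+ 2.
  rewrite -subr_gt0 -(pmulr_rgt0 _ (_ : 0 < n + 2 * y)); last by lra.
  have -> : (n + 2 * y) * ((c - n * m) ^+ 2 - 2 * y * (n * m * (1 - m))) =
      n * (L ^+ 2 - D).
    by rewrite /c /L /D; field; rewrite lt0r_neq0.
  by rewrite mulr_gt0 // subr_gt0.
(* [Q0] leaves the sign of [c - n * m] open. Were it negative, [0 < L] and [0 < c] would bound
   [n * m - c] by y (1 - 2m) and by n m; the product of these bounds contradicts [Q0]. *)
have cm : n * m <= c.
  rewrite leNgt; apply/negP => cnm.
  have d1 : n * m - c < y * (1 - 2 * m) by move: L0; rewrite /L /c; lra.
  have d2 : n * m - c < n * m by lra.
  have := ltr_pM _ _ d1 d2; rewrite !subr_ge0 => /(_ (ltW cnm) (ltW cnm)) h.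
  have h' : y * (1 - 2 * m) * (n * m) <= 2 * y * (n * m * (1 - m)).
    rewrite -subr_ge0.
    have -> : 2 * y * (n * m * (1 - m)) - y * (1 - 2 * m) * (n * m) = y * (n * m).
      by ring.
    by rewrite !mulr_ge0 // ltW.
  by move: Q0; rewrite -sqrrN opprB expr2 ltNge (ltW (lt_le_trans h h')).
have : Num.sqrt (2 * y * (n * m * (1 - m))) <= c - n * m.
  rewrite -[leRHS]ger0_norm ?subr_ge0 // -sqrtr_sqr ler_sqrt ?ltW //.
  by rewrite (le_lt_trans _ Q0) // !mulr_ge0 ?subr_ge0 // ltW.
by rewrite /c; lra.
Qed.

(** Exchanging the outcomes 0 and 1 turns nu into 1 - nu; the two radicands then agree. *)
Lemma psi_upperE y nu N : (0 < N)%N -> 0 < y ->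
  psi_upper nu N y = 1 - psi_lower (1 - nu) N y.
Proof.
move=> N0 y0; have n0 : 0 < N%:R :> R by rewrite ltr0n.
rewrite /psi_upper /psi_lower ltrBrDr addrC -ltrBrDr.
case: ifP => _; last by rewrite subr0.
set n : R := N%:R in n0 *.
have -> : 2 * n * nu * y + 5 * y ^+ 2 / 3 - 2 * y / n * (y / 3 + nu * n) ^+ 2 =
    2 * n * (1 - nu) * y + y ^+ 2 / 3 - 2 * y / n * (y / 3 - (1 - nu) * n) ^+ 2.
  by field; rewrite lt0r_neq0.
by set r := Num.sqrt _; field; rewrite lt0r_neq0 //; lra.
Qed.

Lemma psi_upper_lt y nu m N : (0 < N)%N -> 0 < y -> 0 <= m <= 1 ->
  psi_upper nu N y < m ->
  y / 3 + Num.sqrt (2 * y * (N%:R * m * (1 - m))) <= N%:R * (m - nu).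
Proof.
move=> N0 y0 /andP[m0 m1]; rewrite psi_upperE // => um.
have := @psi_lower_gt y (1 - nu) (1 - m) N N0 y0.
have -> : N%:R * (1 - m) * (1 - (1 - m)) = N%:R * m * (1 - m) by ring.
have -> : 1 - nu - (1 - m) = m - nu by ring.
by apply; [apply/andP; split; lra | lra].
Qed.

(** Candidates for the parameter t of [tilt], whose optimum is 2y/w for w = sqrt (2 y v). At the
    starting value t + 3 = 3y, so the inequality of [grid_cover] holds there as soon as 0 <= t w <=
    2y. *)
Definition grid y j : R := 3 * (y - 1) * (1 - y^-1) ^+ j.

Lemma grid_ge0 y j : 1 < y -> 0 <= grid y j.
Proof.
move=> y1; rewrite /grid mulr_ge0 ?exprn_ge0 //; first by lra.
by rewrite subr_ge0 invf_le1 //; lra.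
Qed.

(** Since 1 - 1/y <= exp (-1/y) and M > y (ln ((y - 1) n) + 2), the grid point is at most 3 exp (-2)
    / n; the 2 next to the logarithm absorbs the 3. *)
Lemma grid_last y n M : 1 < y -> 1 <= n ->
  y * (ln ((y - 1) * n) + 2) + 2 < M.+2%:R -> grid y M <= n^-1.
Proof.
move=> y1 n1 FM; have yn : 0 < (y - 1) * n by rewrite mulr_gt0 //; lra.
have y0 : 0 < y by lra.
have rhoM : (1 - y^-1) ^+ M <= expR (- (ln ((y - 1) * n) + 2)).
  apply: le_trans (_ : expR (- y^-1 * M%:R) <= _).
    rewrite mulrC expRM_natl lerXn2r ?nnegrE ?expR_ge0 //.
      by rewrite subr_ge0 invf_le1 // ltW.
    exact: expR_ge1Dx.
  rewrite ler_expR mulNr lerN2 [y^-1 * _]mulrC ler_pdivlMr // [leLHS]mulrC.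
  by move: FM; rewrite -addn2 natrD; lra.
have e2 : 3 <= expR 2 :> R by apply: le_trans (expR_ge1Dx _); lra.
rewrite /grid; apply: le_trans (ler_wpM2l _ rhoM) _; first by lra.
rewrite opprD expRD expRN lnK ?posrE // expRN invfM.
have -> : 3 * (y - 1) * ((y - 1)^-1 / n / expR 2) = n^-1 * (3 / expR 2).
  by field; rewrite !lt0r_neq0 ?expR_gt0 //; lra.
by rewrite ler_piMr ?invr_ge0 ?ler_pdivrMr ?expR_gt0 ?mul1r //; lra.
Qed.

(* Consecutive grid points differ by the factor 1 - 1/y, so the first t with
   t w <= 2 y has 1 - tw/(2y) <= 1/y, unless it is t = 3(y - 1), which is large
   enough for every smaller w. *)
Lemma grid_cover y n w M : 1 < y -> 1 <= n ->
  y * (ln ((y - 1) * n) + 2) + 2 < M.+2%:R -> 0 <= w -> w <= y * n ->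
  exists2 j, (j < M.+1)%N &
    3 * y * (1 - grid y j * w / (2 * y)) ^+ 2 <= grid y j + 3.
Proof.
move=> y1 n1 FM w0 wn; have y0 : 0 < y by lra.
have exj : exists j, grid y j * w <= 2 * y.
  exists M; apply: le_trans (_ : n^-1 * (y * n) <= _).
    by rewrite ler_pM ?grid_ge0 // grid_last.
  by rewrite mulrC mulfK ?lt0r_neq0 //; lra.
case: (ex_minnP exj) => j jw jmin; exists j.
  rewrite ltnS; apply: jmin; apply: le_trans (_ : n^-1 * (y * n) <= _).
    by rewrite ler_pM ?grid_ge0 // grid_last.
  by rewrite mulrC mulfK ?lt0r_neq0 //; lra.
set a := grid y j * w / (2 * y).
have a1 : a <= 1 by rewrite ler_pdivrMr ?mul1r ?mulr_gt0.
have a0 : 0 <= a.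
  by apply: divr_ge0; apply: mulr_ge0 => //; [exact: grid_ge0 | exact: ltW].
case: j => [|j] in jw jmin a a1 a0 *.
  rewrite /grid expr0 mulr1.
  have : (1 - a) ^+ 2 <= 1 by rewrite expr_le1 //; lra.
  by nra.
have jw' : 2 * y < grid y j * w.
  by rewrite ltNge; apply/negP => /jmin; rewrite ltnn.
have rho0 : 0 < 1 - y^-1 by rewrite subr_gt0 invf_lt1.
have ra : 1 - y^-1 <= a.
  rewrite /a {1}/grid exprSr ler_pdivlMr ?mulr_gt0 //.
  have -> : 3 * (y - 1) * ((1 - y^-1) ^+ j * (1 - y^-1)) * w =
     (1 - y^-1) * (grid y j * w) by rewrite /grid; ring.
  by rewrite ler_pM2l // ltW.
have : (1 - a) ^+ 2 <= y^-1 ^+ 2 by rewrite lerXn2r ?nnegrE ?invr_ge0 //; lra.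
have iy1 : y^-1 <= 1 by rewrite invf_le1 // ltW.
move=> h; apply: le_trans (_ : 3 * y * y^-1 ^+ 2 <= _).
  by rewrite ler_pM2l // mulr_gt0.
have -> : 3 * y * y^-1 ^+ 2 = 3 * y^-1 by field; rewrite lt0r_neq0.
by have := @grid_ge0 y j.+1 y1; lra.
Qed.

(** At S = y/3 + w the exponent equals y - 3y (1 - tw/(2y))^2 / (3 + t). The hypothesis on the
    square limits the loss to 1, the source of the factor e. *)
Lemma tilt_cgf_ge y t w v S : 0 < y -> 0 <= t -> w ^+ 2 = 2 * y * v ->
  3 * y * (1 - t * w / (2 * y)) ^+ 2 <= t + 3 -> y / 3 + w <= S ->
  y - 1 <= tilt t * S - cgf t * v.
Proof.
move=> y0 t0 wv ht wS; have t3 : 0 < 3 + t by lra.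
rewrite -(ler_pM2r t3).
have -> : (tilt t * S - cgf t * v) * (3 + t) = 3 * t * S - 3 * t ^+ 2 * v / 2.
  by rewrite /tilt /cgf; field; rewrite lt0r_neq0.
have -> : v = w ^+ 2 / (2 * y) by rewrite wv; field; rewrite lt0r_neq0.
apply: le_trans (_ : 3 * t * (y / 3 + w) - 3 * t ^+ 2 * (w ^+ 2 / (2 * y)) / 2 <= _); last first.
  by rewrite lerB // ler_wpM2l // mulr_ge0.
rewrite -subr_ge0.
have -> : 3 * t * (y / 3 + w) - 3 * t ^+ 2 * (w ^+ 2 / (2 * y)) / 2 -
   (y - 1) * (3 + t) = t + 3 - 3 * y * (1 - t * w / (2 * y)) ^+ 2.
  by field; rewrite lt0r_neq0.
by rewrite subr_ge0.
Qed.

End Intervals.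

(** * Probabilities along cylinders of histories *)

Section Probability.
Variables (R : realType) (disp : measure_display) (T : measurableType disp).
Variable P : probability T R.

Let fin_numP (A : set T) : measurable A -> P A \is a fin_num.
Proof. exact: fin_num_measure. Qed.

Lemma fine_prob_le (A B : set T) : measurable A -> measurable B ->
  A `<=` B -> fine (P A) <= fine (P B).
Proof. by move=> mA mB AB; rewrite fine_le ?fin_numP ?le_measure ?inE. Qed.

(** Only traces on [A] are measured: the event of interest quantifies over all vectors e and is
    controlled inside a cylinder. *)
Lemma fine_prob_setI (A B : set T) : measurable A -> measurable (A `&` ~` B) ->
  fine (P (A `&` B)) = fine (P A) - fine (P (A `&` ~` B)).
Proof.
move=> mA mB.
have AB : A `&` B = A `\` (A `&` ~` B).
  by rewrite setDE setCI setCK setIUr setICr set0U.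
have mAB : measurable (A `&` B) by rewrite AB; exact: measurableD.
rewrite [A in fine (P A) - _](_ : A = (A `&` B) `|` (A `&` ~` B)); last first.
  by rewrite -setIUr setUv setIT.
rewrite measureU ?fineD ?fin_numP ?addrK //.
by rewrite setIACA setICr setI0.
Qed.

Lemma prob_fin_partition (I : finType) (X : T -> I) (A : set T) :
  (forall i, measurable (A `&` [set w | X w = i])) ->
  measurable A /\
  fine (P A) = \sum_i fine (P (A `&` [set w | X w = i])).
Proof.
move=> mAX.
have AE : A = \bigcup_(i in [set` enum I]) (A `&` [set w | X w = i]).
  apply/seteqP; split=> [w Aw|w [i _ []]//].
  by exists (X w); rewrite //= mem_enum.
have fI : finite_set [set` enum I] by exact: finite_seq.
split; first by rewrite AE; exact: fin_bigcup_measurable.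
rewrite [in LHS]AE measure_fin_bigcup //; last first.
  by move=> i j _ _ [w [[_ <-] [_ <-]]].
rewrite -fsbig_seq ?enum_uniq // -sum_fine; last by move=> i _; rewrite fin_numP.
by rewrite [LHS]big_enum.
Qed.

Variables (K d N : nat) (om : T -> trajectory K).
Hypothesis mom : forall (t : int) (k : 'I_K), 1 - d%:Z <= t <= N%:Z ->
  measurable_fun setT (fun w => om w t k).

Lemma measurable_past (h : trajectory K) (t : int) : t <= N%:Z ->
  measurable (past d om h t).
Proof.
move=> tN; rewrite (_ : past d om h t =
  \bigcap_(s in [set s : int | 1 - d%:Z <= s <= t])
    \bigcap_(k in [set: 'I_K]) ((fun w => om w s k) @^-1` [set h s k])).
  rewrite bigcap_mkcond -[X in measurable X]setCK setC_bigcap.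
  apply: measurableC; apply: countable_bigcupT_measurable => [|s].
    exact: countableP.
  apply: measurableC; case: ifPn => [|_]; last exact: measurableT.
  rewrite inE /= => /andP[ds st]; apply: fin_bigcap_measurable => [|k _]; first exact: finite_finset.
  rewrite -[X in measurable X]setTI; apply: mom => //.
  by rewrite ds (le_trans st).
apply/seteqP; split=> w /= H.
  by move=> s st k _; exact: H.
by move=> s k st; exact: H.
Qed.

(** One branching of the tree of histories: by [past_extend], a cylinder splits into those of its
    extensions. *)
Definition extend (h : trajectory K) (t : nat) (x : {ffun 'I_K -> bool}) :
  trajectory K := fun s k => if s == t%:Z then x k else h s k.

Lemma past_extend h t x : past d om (extend h t.+1 x) t.+1%:Z =
  past d om h t%:Z `&` [set w | [ffun k => om w t.+1%:Z k] = x].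
Proof.
apply/seteqP; split=> w /=.
  move=> H; split; last first.
    by apply/ffunP => k; rewrite ffunE H /extend ?eqxx //; lia.
  move=> s k st; rewrite H /extend; last by lia.
  by case: eqP => // sE; lia.
move=> [H <-] s k st; rewrite /extend; case: eqP => [->|sE].
  by rewrite ffunE.
by apply: H; lia.
Qed.

(* Backward induction on t; the measurability of the event is only obtained, and
   only needed, inside the cylinder sets 'past'. *)
Lemma supermartingale_bound (Q : set (trajectory K))
    (W : nat -> trajectory K -> R) :
  (forall h h', (forall (s : int) k, 1 - d%:Z <= s <= N%:Z -> h s k = h' s k) ->
     Q h -> Q h') ->
  (forall h, 0 <= W N h) -> (forall h, Q h -> 1 <= W N h) ->
  (forall h t, (t < N)%N ->
     \sum_x fine (P (past d om (extend h t.+1 x) t.+1%:Z)) *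
       W t.+1 (extend h t.+1 x) <= fine (P (past d om h t%:Z)) * W t h) ->
  forall t h, (t <= N)%N ->
    measurable (past d om h t%:Z `&` [set w | Q (om w)]) /\
    fine (P (past d om h t%:Z `&` [set w | Q (om w)])) <=
      fine (P (past d om h t%:Z)) * W t h.
Proof.
move=> Qloc W0 W1 Wstep t h tN; move: h.
rewrite -(subKn tN); elim: (N - t)%N (leq_subr t N) => [|m IH] mN h.
  rewrite subn0; have mp : measurable (past d om h N%:Z).
    exact: measurable_past.
  (* At time N the cylinder fixes the whole window read by [Q], so [Q] holds on all of it or
     nowhere. *)
  have [Qh|Qh] := pselect (Q h).
    have -> : past d om h N%:Z `&` [set w | Q (om w)] = past d om h N%:Z.
      apply/setIidl => w H; apply: Qloc Qh => s k st; rewrite H //.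
    by split=> //; rewrite ler_peMr ?fine_ge0 ?W1.
  have -> : past d om h N%:Z `&` [set w | Q (om w)] = set0.
    rewrite -subset0 => w [H Qw]; apply: Qh; apply: Qloc Qw => s k st.
    by rewrite H.
  by rewrite measure0 mulr_ge0 ?fine_ge0.
have {}IH := IH (ltnW mN).
set t' := (N - m.+1)%N; have tE : (N - m = t'.+1)%N by rewrite /t'; lia.
rewrite tE in IH.
pose X w := [ffun k => om w t'.+1%:Z k].
have pE x : past d om h t'%:Z `&` [set w | Q (om w)] `&` [set w | X w = x] =
    past d om (extend h t'.+1 x) t'.+1%:Z `&` [set w | Q (om w)].
  by rewrite past_extend setIAC.
have [|mQ ->] := @prob_fin_partition _ X
    (past d om h t'%:Z `&` [set w | Q (om w)]).
  by move=> x; rewrite pE; have [] := IH (extend h t'.+1 x).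
split=> //; apply: le_trans (Wstep h t' _); last by rewrite /t'; lia.
by apply: ler_sum => x _; rewrite pE; have [] := IH (extend h t'.+1 x).
Qed.

End Probability.

(** * Scalar form of the regression, and the exponential weights *)

Section Regression.
Variables (R : realType) (K d : nat).
Implicit Types (i : 'I_(kappa K d)) (om h : trajectory K) (t : int).
Implicit Types (beta : 'cV[R]_(kappa K d)).

(* Row i of eta om t has a single possibly nonzero entry: 'active i om t' in
   column 'target i'. *)
Definition target i : 'I_K :=
  match ord_coord i with inl k => k | inr (_, k, _) => k end.

Definition active i om t : bool :=
  match ord_coord i with inl _ => true | inr (s, _, l) => om (t - s.+1%:Z) l end.

Definition obs i om t : R := (active i om t)%:R * (om t (target i))%:R.

Definition mean beta i om t : R := (active i om t)%:R * rate beta om t (target i).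

Lemma eta_mulE om t (v : 'cV[R]_K) i :
  (@eta R K d om t *m v) i 0 = (active i om t)%:R * v (target i) 0.
Proof.
rewrite mxE (bigD1 (target i)) //= big1 ?addr0.
  rewrite mxE /target /active; case: (ord_coord i) => [k|[[s k] l]];
    by rewrite eqxx ?mul1r.
move=> k; rewrite !mxE /target; case: (ord_coord i) => [k'|[[s k'] l]];
  by rewrite eq_sym => /negPf ->; rewrite !mul0r.
Qed.

Lemma avecE N om i : (0 < N)%N ->
  N%:R * avec R d N om i 0 = \sum_(1 <= s < N.+1) obs i om s%:Z.
Proof.
move=> N0; rewrite /avec mxE mulrA divff ?pnatr_eq0 -?lt0n // mul1r.
rewrite summxE; apply: eq_bigr => s _; by rewrite eta_mulE mxE.
Qed.

Lemma Amat_mulE N om beta i : (0 < N)%N ->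
  N%:R * (@Amat R K d N om *m beta) i 0 =
  \sum_(1 <= s < N.+1) mean beta i om s%:Z.
Proof.
move=> N0; rewrite /Amat -scalemxAl mxE mulrA divff ?pnatr_eq0 -?lt0n // mul1r.
rewrite mulmx_suml summxE; apply: eq_bigr => s _.
by rewrite -mulmxA eta_mulE eta_trE.
Qed.

Lemma eta_local om h t :
  (forall r l, t - d%:Z <= r < t -> om r l = h r l) ->
  @eta R K d om t = @eta R K d h t.
Proof.
move=> omh; apply/matrixP => i k; rewrite !mxE.
case: (ord_coord i) => // -[[s k'] l]; rewrite omh //.
by have := ltn_ord s; lia.
Qed.

Lemma active_local i om h t :
  (forall r l, t - d%:Z <= r < t -> om r l = h r l) ->
  active i om t = active i h t.
Proof.
move=> omh; rewrite /active; case: (ord_coord i) => // -[[s k'] l]; rewrite omh //.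
by have := ltn_ord s; lia.
Qed.

Lemma rate_local beta om h t k :
  (forall r l, t - d%:Z <= r < t -> om r l = h r l) ->
  rate beta om t k = rate beta h t k.
Proof. by move=> omh; rewrite -!eta_trE (eta_local omh). Qed.

Lemma rate_itv beta om t k : @admissible R K d beta -> 0 <= rate beta om t k <= 1.
Proof.
move=> /(_ k)[lo hi]; apply/andP; split; [apply: le_trans lo _|apply: le_trans hi].
- rewrite lerD2l; apply: ler_sum => s _; apply: ler_sum => l _.
  by case: om; rewrite ?mulr1 ?mulr0 ge_min lexx ?orbT.
- rewrite lerD2l; apply: ler_sum => s _; apply: ler_sum => l _.
  by case: om; rewrite ?mulr1 ?mulr0 le_max lexx ?orbT.
Qed.

Lemma mean_itv beta i om t : @admissible R K d beta -> 0 <= mean beta i om t <= 1.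
Proof.
rewrite /mean => /(rate_itv om t (target i)).
by case: active; rewrite ?mul1r // mul0r lexx ler01.
Qed.

(** Jensen's inequality for x (1 - x), obtained by expanding the sum of the squares (f s - m)^2. *)
Lemma sum_variance_le (f : nat -> R) (N : nat) (m : R) :
  N%:R * m = \sum_(1 <= s < N.+1) f s ->
  \sum_(1 <= s < N.+1) f s * (1 - f s) <= N%:R * m * (1 - m).
Proof.
move=> fm; have : 0 <= \sum_(1 <= s < N.+1) (f s - m) ^+ 2.
  by apply: sumr_ge0 => s _; exact: sqr_ge0.
rewrite (eq_bigr (fun s => (1 - 2 * m) * f s + m ^+ 2 - f s * (1 - f s))).
  rewrite sumrB big_split /= -mulr_sumr -fm sumr_const_nat subn1 /=.
  by rewrite -mulr_natl; set n : R := N%:R => ?; lra.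
by move=> s _; ring.
Qed.

(** Logarithm of Bernstein's exponential supermartingale for coordinate [i]; [b = false] detects a
    too large observed average, [b = true] a too small one. *)
Definition log_weight beta i (b : bool) (g : R) om (n : nat) : R :=
  \sum_(1 <= s < n.+1)
    (tilt g * ((-1) ^+ b * (obs i om s%:Z - mean beta i om s%:Z)) -
     cgf g * (mean beta i om s%:Z * (1 - mean beta i om s%:Z))).

Lemma log_weight_ge beta i (b : bool) (g : R) om N (S v m : R) : (0 < N)%N -> 0 <= g ->
  m = (@Amat R K d N om *m beta) i 0 -> v = N%:R * m * (1 - m) ->
  S = (-1) ^+ b * (N%:R * (avec R d N om i 0 - m)) ->
  tilt g * S - cgf g * v <= log_weight beta i b g om N.
Proof.
move=> N0 g0 mE -> ->; rewrite /log_weight sumrB -!mulr_sumr sumrB.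
rewrite -avecE // -Amat_mulE // -mE mulrBr lerD2l lerN2.
by rewrite ler_wpM2l ?cgf_ge0 // sum_variance_le // mE Amat_mulE.
Qed.

Lemma extend_eq h n x r k : r != n%:Z -> @extend K h n x r k = h r k.
Proof. by rewrite /extend => /negPf ->. Qed.

(** Means and activity up to time n + 1 read only times up to n, so [x] enters through the last
    observation alone. *)
Lemma log_weight_extend beta i (b : bool) (g : R) h n x :
  log_weight beta i b g (extend h n.+1 x) n.+1 =
  log_weight beta i b g h n +
  (tilt g * ((-1) ^+ b * ((active i h n.+1%:Z)%:R * (x (target i))%:R -
                          mean beta i h n.+1%:Z)) -
   cgf g * (mean beta i h n.+1%:Z * (1 - mean beta i h n.+1%:Z))).
Proof.
have loc s : (s <= n.+1)%N -> forall r l, s%:Z - d%:Z <= r < s%:Z ->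
    extend h n.+1 x r l = h r l.
  by move=> sn r l rs; rewrite extend_eq //; lia.
have meanE s : (s <= n.+1)%N ->
    mean beta i (extend h n.+1 x) s%:Z = mean beta i h s%:Z.
  move=> sn; rewrite /mean (active_local _ (loc s sn)).
  by rewrite (rate_local _ _ (loc s sn)).
rewrite {1}/log_weight big_nat_recr //= meanE //; congr (_ + _); last first.
  congr (tilt g * (_ * (_ - _)) - _).
  by rewrite /obs (active_local _ (loc n.+1 _)) // /extend eqxx.
apply: eq_big_nat => s /andP[_ sn]; rewrite meanE; last exact: ltnW.
congr (tilt g * (_ * (_ - _)) - _).
rewrite /obs (active_local _ (loc s _)); last exact: ltnW.
by rewrite extend_eq //; lia.
Qed.

Lemma event_local X N y e om h :
  (forall (s : int) k, 1 - d%:Z <= s <= N%:Z -> om s k = h s k) ->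
  (e_lower X N om y e = @e_lower R K d X N h y e) *
  (e_upper X N om y e = @e_upper R K d X N h y e).
Proof.
move=> omh; have etaE s : (0 < s < N.+1)%N ->
    @eta R K d om s%:Z = @eta R K d h s%:Z.
  by move=> sN; apply: eta_local => r l rs; apply: omh; lia.
have AE : Amat R d N om = Amat R d N h.
  by rewrite /Amat; congr (_ *: _); apply: eq_big_nat => s /etaE ->.
have aE : avec R d N om = avec R d N h.
  rewrite /avec; congr (_ *: _); apply: eq_big_nat => s sN; rewrite etaE //.
  congr (_ *m _); apply/colP => k; rewrite !mxE omh //.
  by apply/andP; split; lia.
by rewrite /e_lower /e_upper /feasible AE aE.
Qed.

End Regression.

(** * One-step conditional expectations *)

Section Martingale.
Variables (R : realType) (K d N : nat).
Variables (disp : measure_display) (T : measurableType disp).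
Variables (P : probability T R) (om : T -> trajectory K).
Variables (beta : 'cV[R]_(kappa K d)).
Hypothesis omP : bernoulli_process N P beta om.

(** Conditional expectation of G of a single coordinate, which involves only its marginal law.
    Keeping the cylinder's probability as a factor includes null cylinders. *)
Lemma sum_extend h (n : nat) k (G : bool -> R) : (n < N)%N ->
  \sum_x fine (P (past d om (extend h n.+1 x) n.+1%:Z)) * G (x k) =
  fine (P (past d om h n%:Z)) *
    (rate beta h n.+1%:Z k * G true + (1 - rate beta h n.+1%:Z k) * G false).
Proof.
move=> nN; have [mom cond] := omP.
pose X w := [ffun k' => om w n.+1%:Z k'].
have mpast x : measurable (past d om (extend h n.+1 x) n.+1%:Z).
  by apply: measurable_past mom _ _ _; lia.
have mp : measurable (past d om h n%:Z) by apply: measurable_past mom _ _ _; lia.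
pose A := past d om h n%:Z `&` [set w | om w n.+1%:Z k].
have AX x : A `&` [set w | X w = x] =
    if x k then past d om (extend h n.+1 x) n.+1%:Z else set0.
  rewrite past_extend; case: ifPn => xk; apply/seteqP; split=> w //=.
  - by move=> [[? ?] ?].
  - by move=> [? Xx]; split=> //; split=> //; move: xk; rewrite -Xx ffunE.
  - by move=> [[_ omk] Xx]; move: xk; rewrite -Xx ffunE omk.
have [mA PA] : measurable A /\ fine (P A) =
    \sum_x fine (P (A `&` [set w | X w = x])).
  by apply: prob_fin_partition => x; rewrite AX; case: ifP.
have [_ Pp] : measurable (past d om h n%:Z) /\ fine (P (past d om h n%:Z)) =
    \sum_x fine (P (past d om h n%:Z `&` [set w | X w = x])).
  by apply: prob_fin_partition => x; rewrite -past_extend.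
have Arate : fine (P A) = rate beta h n.+1%:Z k * fine (P (past d om h n%:Z)).
  have n1 : n.+1%:Z - 1 = n%:Z by lia.
  have : (0 <= P (past d om h n%:Z))%E by [].
  rewrite le_eqVlt => /predU1P[p0|p0]; last first.
    have nN1 : 1 <= n.+1%:Z <= N%:Z by lia.
    have := cond n.+1%:Z k h nN1; rewrite n1 => /(_ p0) <-.
    rewrite /cond_prob setIC divfK // gt_eqF // fine_gt0 // p0 /=.
    by rewrite ltey_eq fin_num_measure.
  rewrite -p0 mulr0; apply/eqP; rewrite eq_le fine_ge0 // andbT.
  have := @fine_prob_le _ _ _ P A (past d om h n%:Z) mA mp.
  by rewrite -p0; apply; exact: subIsetl.
(* G is affine in its boolean argument: G false + (G true - G false) times the indicator. *)
rewrite (eq_bigr (fun x => G false * fine (P (past d om h n%:Z `&`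
    [set w | X w = x])) + (G true - G false) * fine (P (A `&` [set w | X w = x])))).
  by rewrite big_split /= -!mulr_sumr -PA -Pp Arate; ring.
move=> x _; rewrite AX past_extend; case: (x k); first by ring.
by rewrite measure0 mulr0 addr0 mulrC.
Qed.

Lemma log_weight_supermartingale i (b : bool) (g : R) h n : 0 <= g ->
  @admissible R K d beta -> (n < N)%N ->
  \sum_x fine (P (past d om (extend h n.+1 x) n.+1%:Z)) *
    expR (log_weight beta i b g (extend h n.+1 x) n.+1) <=
  fine (P (past d om h n%:Z)) * expR (log_weight beta i b g h n).
Proof.
move=> g0 adm nN.
set q := rate beta h n.+1%:Z (target i); set z := active i h n.+1%:Z.
pose G (c : bool) : R := expR (log_weight beta i b g h n) *
  expR (tilt g * ((-1) ^+ b * (z%:R * c%:R - z%:R * q)) -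
        cgf g * (z%:R * q * (1 - z%:R * q))).
rewrite (eq_bigr (fun x : {ffun 'I_K -> bool} =>
  fine (P (past d om (extend h n.+1 x) n.+1%:Z)) * G (x (target i)))); last first.
  by move=> x _; rewrite log_weight_extend expRD.
rewrite sum_extend // ler_wpM2l ?fine_ge0 // -/q /G.
rewrite [q * _]mulrCA [(1 - q) * _]mulrCA -mulrDr ler_piMr ?expR_ge0 //.
by apply: masked_bernoulli_mgf => //; exact: rate_itv.
Qed.

End Martingale.

(** A violated coordinate supplies [i], the violated side supplies [b], and [grid_cover] at w = sqrt
    (2 y v) supplies [j]. *)
Lemma log_weight_cover (R : realType) (K d N M : nat) (X : set 'cV[R]_(kappa K d))
    (beta : 'cV[R]_(kappa K d)) (h : trajectory K) (y : R) :
  (0 < N)%N -> @admissible R K d beta -> X beta -> 1 < y ->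
  y * (ln ((y - 1) * N%:R) + 2) + 2 < M.+2%:R ->
  ~ feasible X N h y beta ->
  exists i b (j : 'I_M.+1), y - 1 <= log_weight beta i b (grid y j) h N.
Proof.
move=> N0 adm Xb y1 FM infeasible; have y0 : 0 < y by lra.
have n1 : 1 <= N%:R :> R by rewrite ler1n.
have [i iP] : exists i, ~ (psi_lower (avec R d N h i 0) N y <=
    (Amat R d N h *m beta) i 0 /\
    (Amat R d N h *m beta) i 0 <= psi_upper (avec R d N h i 0) N y).
  by apply/existsNP => feas; apply: infeasible.
set m := (Amat R d N h *m beta) i 0 in iP *; set nu := avec R d N h i 0 in iP *.
have n0 : 0 < N%:R :> R by rewrite ltr0n.
have m01 : 0 <= m <= 1.
  rewrite -(pmulr_rge0 _ n0) -[m <= 1](ler_pM2l n0) mulr1 /m Amat_mulE //.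
  rewrite sumr_ge0 /=; last by move=> s _; case/andP: (mean_itv i h s adm).
  have -> : N%:R = \sum_(1 <= s < N.+1) 1 :> R by rewrite sumr_const_nat subn1.
  by apply: ler_sum => s _; case/andP: (mean_itv i h s adm).
pose v := N%:R * m * (1 - m); pose w := Num.sqrt (2 * y * v).
have v0 : 0 <= v.
  by case/andP: m01 => ? ?; rewrite /v !mulr_ge0 ?subr_ge0 // ltW.
have wv : w ^+ 2 = 2 * y * v by rewrite sqr_sqrtr // mulr_ge0 // mulr_ge0 // ltW.
(* As m (1 - m) <= 1/4, w^2 is at most yN/2, which is below (yN)^2 because yN >= 1. *)
have wn : w <= y * N%:R.
  have yn0 : 0 <= y * N%:R by rewrite mulr_ge0 // ltW.
  rewrite -[leRHS]ger0_norm // -sqrtr_sqr ler_sqrt ?sqr_ge0 //.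
  have m4 : m * (1 - m) <= 4^-1.
    by have := sqr_ge0 (m - 2^-1); rewrite -subr_ge0; lra.
  have -> : 2 * y * v = 2 * (y * N%:R) * (m * (1 - m)) by rewrite /v; ring.
  have yn1 : 1 <= y * N%:R by rewrite mulr_ege1 // ltW.
  apply: le_trans (_ : 2 * (y * N%:R) * 4^-1 <= _).
    by rewrite ler_wpM2l // mulr_ge0.
  by nra.
have [j jM jw] := grid_cover y1 n1 FM (sqrtr_ge0 _) wn.
have g0 := grid_ge0 j y1.
suff [b Sb] : exists b : bool, y / 3 + w <= (-1) ^+ b * (N%:R * (nu - m)).
  exists i, b, (Ordinal jM).
  apply: le_trans (tilt_cgf_ge y0 g0 wv jw Sb) _.
  exact: log_weight_ge.
have [lo|lo] := leP (psi_lower nu N y) m; last first.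
  exists false; rewrite expr0 mul1r; exact: psi_lower_gt.
have [hi|hi] := leP m (psi_upper nu N y); first by case: iP.
exists true; rewrite expr1 mulN1r -mulrN opprB; exact: psi_upper_lt.
Qed.

(* The last hypothesis excludes only (y - 1) N < exp (-2), i.e. y close to 1:
   there the factor y (ln ((y - 1) N) + 2) + 2 can vanish or become negative,
   and the asserted lower bound would be >= 1 (even > 1). *)
Theorem lemma3 (R : realType) (K d N : nat)
    (disp : measure_display) (T : measurableType disp) (P : probability T R)
    (om : T -> trajectory K) (beta : 'cV[R]_(kappa K d))
    (X : set 'cV[R]_(kappa K d)) (h0 : trajectory K) (y : R) :
  (1 <= K)%N -> (1 <= d)%N -> (1 <= N)%N ->
  convex_set X -> compact X -> X `<=` @admissible R K d -> X beta ->
  bernoulli_process N P beta om ->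
  (0 < P (past d om h0 0))%E ->
  1 < y ->
  1 <= y * (ln ((y - 1) * N%:R) + 2) + 2 ->
  1 - 2 * (kappa K d)%:R * expR 1 *
      (y * (ln ((y - 1) * N%:R) + 2) + 2) * expR (- y)
  <= cond_prob P
       [set w | forall e : 'cV[R]_(kappa K d),
          (e_lower X N (om w) y e <= ((e^T *m beta) 0 0)%:E)%E /\
          (((e^T *m beta) 0 0)%:E <= e_upper X N (om w) y e)%E]
       (past d om h0 0).
Proof.
move=> _ _ N0 _ _ Xadm Xb omP past0 y1 F1.
set F := y * _ + 2 in F1 *; set E := [set w | _].
have adm : @admissible R K d beta by exact: Xadm.
(* [M.+1] is the integer part of [F], nonzero by [F1]. [MF] bounds the number of grid points; [FM]
   lets the grid reach far enough. *)
have [M /andP[MF FM]] : exists M : nat, (M.+1%:R <= F) && (F < M.+2%:R).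
  have F0 : 0 <= F by exact: le_trans F1.
  have := truncn_itv F0; case: (Num.truncn F) => [|M] MF; last by exists M.
  by move: MF; rewrite ltNge F1 andbF.
pose Q : set (trajectory K) := [set h | ~ forall e : 'cV[R]_(kappa K d),
  (e_lower X N h y e <= ((e^T *m beta) 0 0)%:E)%E /\
  (((e^T *m beta) 0 0)%:E <= e_upper X N h y e)%E].
pose Ix : finType := ('I_(kappa K d) * bool * 'I_M.+1)%type.
(* The union bound over coordinates, signs and grid points becomes one supermartingale, scaled so
   that a single log-weight of y - 1 already makes it at least 1. *)
pose W (t : nat) (h : trajectory K) : R :=
  \sum_(a : Ix) expR (log_weight beta a.1.1 a.1.2 (grid y a.2) h t) * expR (1 - y).
have [mom cond] := omP.
have [|||||mQ PQ] := @supermartingale_bound _ _ _ P _ d N om mom Q W _ _ _ _ 0 h0 _.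
- move=> h h' hh Qh Eh'; apply: Qh => e; have := Eh' e.
  by rewrite !(event_local X y e hh).
- by move=> h; apply: sumr_ge0 => a _; rewrite mulr_ge0 ?expR_ge0.
- move=> h Qh; have [|i [b [j ij]]] :=
      @log_weight_cover R K d N M X beta h y N0 adm Xb y1 FM.
    move=> feas; apply: Qh => e; split.
      by apply: ereal_inf_lbound; exists beta.
    by apply: ereal_sup_ubound; exists beta.
  rewrite /W (bigD1 ((i, b, j) : Ix)) //= ler_wpDr //.
    by apply: sumr_ge0 => a _; rewrite mulr_ge0 ?expR_ge0.
  by rewrite -expRD -[leLHS]expR0 ler_expR /=; lra.
- move=> h t tN; rewrite /W mulr_sumr.
  under eq_bigr do rewrite mulr_sumr.
  rewrite exchange_big /=; apply: ler_sum => a _.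
  under eq_bigr do rewrite mulrA.
  rewrite -mulr_suml mulrA ler_wpM2r ?expR_ge0 //.
  by apply: (log_weight_supermartingale omP) => //; exact: grid_ge0.
- by [].
have mp : measurable (past d om h0 0) by apply: (measurable_past mom).
have p0 : 0 < fine (P (past d om h0 0)).
  by rewrite fine_gt0 // past0 /= ltey_eq fin_num_measure.
rewrite /cond_prob setIC (fine_prob_setI _ mp) // ler_pdivlMr //.
rewrite mulrBl mul1r lerD2l lerN2.
apply: le_trans PQ _; rewrite mulrC ler_wpM2r ?(ltW p0) //.
(* At time 0 the log-weights are empty sums, so [W] is the number of its terms, 2 kappa (M + 1),
   times exp (1 - y). *)
rewrite /W; under eq_bigr do rewrite /log_weight big_nil expR0 mul1r.
rewrite sumr_const -[leLHS]mulr_natl.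
have -> : #|Ix|%:R = (kappa K d)%:R * 2 * M.+1%:R :> R.
  by rewrite !card_prod !card_ord card_bool !natrM.
rewrite expRD mulrA; apply: ler_wpM2r; first exact: expR_ge0.
rewrite [leRHS]mulrAC; apply: ler_wpM2r; first exact: expR_ge0.
by rewrite [_ * 2]mulrC ler_wpM2l ?mulr_ge0.
Qed.
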